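(* Let $X\subseteq\omega$. If $X$ is low (respectively, high) for $\Sigma$-Feiner, then $X$ is low (respectively, high) for $\Delta$-Feiner.
   Context: $X^{(m)}$ denotes the $m$th Turing jump of $X$, with $X^{(-1)}=X^{(0)}=X$. Fix $a,b\in\omega$ with $b\geq 1$. For $X\subseteq\omega$, a set $S\subseteq\omega$ is $\Delta^0_{(bn+a)}(X)$ if there is a single Turing functional $\Phi_e$ such that for all $n$, $\Phi_e^{X^{(bn+a-1)}}(n)$ converges, with value $1$ if $n\in S$ and $0$ if $n\notin S$. A set $S$ is $\Sigma^0_{(bn+a)}(X)$ if there is a single computably enumerable operator $W_e$ such that for all $n$, $n\in S\iff n\in W_e^{X^{(bn+a-1)}}$. For $\Gamma$ either $\Delta^0_{(bn+a)}$ or $\Sigma^0_{(bn+a)}$: $X$ is low for $\Gamma$ if every $S\in\Gamma(X)$ belongs to $\Gamma(\emptyset)$; $X$ is high for $\Gamma$ if every $S\in\Gamma(\emptyset')$ belongs to $\Gamma(X)$. A set $X$ is low (respectively, high) for $\Delta$-Feiner if it is low (respectively, high) for $\Delta^0_{(bn+a)}$ for some $a,b\in\omega$ with $b\geq 1$; it is low (respectively, high) for $\Sigma$-Feiner if it is low (respectively, high) for $\Sigma^0_{(bn+a)}$ for some $a,b\in\omega$ with $b\geq 1$. *)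

(* Defs.v *)
From Stdlib Require Import Arith Cantor Ensembles.

Arguments In {U} _ _.

(** * Oracle computation

    Turing functionals are presented as the partial recursive functionals of
    Kleene: the least class of partial unary functions containing the basic
    functions below and the characteristic function of the oracle, and closed
    under pairing, composition, primitive recursion and minimization.  Several
    arguments are passed as one via the Cantor bijection. *)

Notation "⟨ x , y ⟩" := (Cantor.to_nat (x, y)) (at level 0, x at level 200).

Inductive prog : Type :=
| Zero | Succ | Fst | Snd | Oracle
| Pair (f g : prog)
| Comp (f g : prog)
| Prec (f g : prog)
| Mu (f : prog).

(** [eval X c x y]: program [c], run with oracle [X] on input [x], halts with
    output [y].
    - [Prec f g] sends ⟨a, 0⟩ to f(a) and ⟨a, n+1⟩ to g⟨a, ⟨n, r⟩⟩, where [r]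
      is its value at ⟨a, n⟩.
    - [Mu f] sends [x] to the least [y] with f⟨x, y⟩ = 0, all f⟨x, m⟩ with
      [m < y] being required to converge. *)
Fixpoint eval (X : Ensemble nat) (c : prog) (x y : nat) : Prop :=
  match c with
  | Zero => y = 0
  | Succ => y = S x
  | Fst => y = fst (Cantor.of_nat x)
  | Snd => y = snd (Cantor.of_nat x)
  | Oracle => (In X x /\ y = 1) \/ (~ In X x /\ y = 0)
  | Pair f g => exists u v, eval X f x u /\ eval X g x v /\ y = ⟨u, v⟩
  | Comp f g => exists u, eval X g x u /\ eval X f u y
  | Prec f g =>
      let a := fst (Cantor.of_nat x) in
      nat_rect (fun _ => nat -> Prop)
        (eval X f a)
        (fun n P z => exists r, P r /\ eval X g ⟨a, ⟨n, r⟩⟩ z)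
        (snd (Cantor.of_nat x)) y
  | Mu f =>
      eval X f ⟨x, y⟩ 0 /\
      forall m, m < y -> exists k, eval X f ⟨x, m⟩ (S k)
  end.

Fixpoint code (c : prog) : nat :=
  match c with
  | Zero => ⟨0, 0⟩
  | Succ => ⟨1, 0⟩
  | Fst => ⟨2, 0⟩
  | Snd => ⟨3, 0⟩
  | Oracle => ⟨4, 0⟩
  | Pair f g => ⟨5, ⟨code f, code g⟩⟩
  | Comp f g => ⟨6, ⟨code f, code g⟩⟩
  | Prec f g => ⟨7, ⟨code f, code g⟩⟩
  | Mu f => ⟨8, code f⟩
  end.

(** [Phi e X x y] is Φ_e^X(x) = y.  If [e] is not the code of a program, then
    Φ_e is nowhere defined. *)
Definition Phi (e : nat) (X : Ensemble nat) (x y : nat) : Prop :=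
  exists c, code c = e /\ eval X c x y.

Lemma code_inj (c d : prog) : code c = code d -> c = d.
Proof.
assert (E : forall x y u v, ⟨x, y⟩ = ⟨u, v⟩ -> x = u /\ y = v).
{ intros x y u v H; apply Cantor.to_nat_inj in H.
  split; [exact (f_equal fst H) | exact (f_equal snd H)]. }
revert d; induction c; intros []; cbn [code]; intros H;
  apply E in H as [T H]; try discriminate T; try reflexivity;
  try apply E in H as [H1 H2]; f_equal; auto.
Qed.

Lemma eval_functional (X : Ensemble nat) (c : prog) (x y z : nat) :
  eval X c x y -> eval X c x z -> y = z.
Proof.
revert x y z; induction c as [| | | | |f IHf g IHg|f IHf g IHg|f IHf g IHg|f IHf];
  cbn [eval]; intros x y z; try congruence.
- intuition congruence.
- intros (u & v & Hu & Hv & ->) (u' & v' & Hu' & Hv' & ->).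
  now rewrite (IHf _ _ _ Hu Hu'), (IHg _ _ _ Hv Hv').
- intros (u & Hu & Hy) (u' & Hu' & Hz).
  rewrite (IHg _ _ _ Hu Hu') in Hy; eauto.
- cbv zeta; generalize (fst (Cantor.of_nat x)) as a.
  induction (snd (Cantor.of_nat x)) as [|n IHn] in y, z |- *; cbn; intros a.
  + apply IHf.
  + intros (r & Hr & Hy) (s & Hs & Hz).
    rewrite (IHn _ _ _ Hr Hs) in Hy; eauto.
- intros [Hy Ly] [Hz Lz].
  destruct (Nat.lt_trichotomy y z) as [H|[H|H]]; trivial; exfalso.
  + destruct (Lz _ H) as [k Hk]; discriminate (IHf _ _ _ Hy Hk).
  + destruct (Ly _ H) as [k Hk]; discriminate (IHf _ _ _ Hz Hk).
Qed.

Lemma Phi_functional (e : nat) (X : Ensemble nat) (x y z : nat) :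
  Phi e X x y -> Phi e X x z -> y = z.
Proof.
intros (c & <- & Hy) (d & Hd & Hz).
apply code_inj in Hd; subst d; exact (eval_functional _ _ _ _ _ Hy Hz).
Qed.

Definition W (e : nat) (X : Ensemble nat) : Ensemble nat :=
  fun x => exists y, Phi e X x y.

Definition jump (X : Ensemble nat) : Ensemble nat :=
  fun e => In (W e X) e.

Definition jumps (m : nat) (X : Ensemble nat) : Ensemble nat :=
  Nat.iter m jump X.

(** * The classes Δ^0_{(bn+a)}(X) and Σ^0_{(bn+a)}(X)

    Subtraction is truncated, which renders the convention X^{(-1)} = X^{(0)}:
    the value -1 of b * n + a - 1 is replaced by 0. *)

Definition Delta_class (a b : nat) (X S : Ensemble nat) : Prop :=
  exists e, forall n,
    (In S n -> Phi e (jumps (b * n + a - 1) X) n 1) /\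
    (~ In S n -> Phi e (jumps (b * n + a - 1) X) n 0).

Definition Sigma_class (a b : nat) (X S : Ensemble nat) : Prop :=
  exists e, forall n, In S n <-> In (W e (jumps (b * n + a - 1) X)) n.

(** In [low_for] and [high_for], [Gamma X S] stands for S ∈ Γ(X). *)

Definition low_for (Gamma : Ensemble nat -> Ensemble nat -> Prop)
    (X : Ensemble nat) : Prop :=
  forall S, Gamma X S -> Gamma (Empty_set nat) S.

Definition high_for (Gamma : Ensemble nat -> Ensemble nat -> Prop)
    (X : Ensemble nat) : Prop :=
  forall S, Gamma (jump (Empty_set nat)) S -> Gamma X S.

Definition low_for_Delta_Feiner (X : Ensemble nat) : Prop :=
  exists a b, 1 <= b /\ low_for (Delta_class a b) X.

Definition high_for_Delta_Feiner (X : Ensemble nat) : Prop :=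
  exists a b, 1 <= b /\ high_for (Delta_class a b) X.

Definition low_for_Sigma_Feiner (X : Ensemble nat) : Prop :=
  exists a b, 1 <= b /\ low_for (Sigma_class a b) X.

Definition high_for_Sigma_Feiner (X : Ensemble nat) : Prop :=
  exists a b, 1 <= b /\ high_for (Sigma_class a b) X.

(* Main.v *)
Require Import Defs.
From Stdlib Require Import Arith Cantor Ensembles.
From Stdlib Require Import Lia Classical ClassicalEpsilon.

(** The same [a] and [b] work.  The point is a form of Post's theorem that holds
    level by level: a set is Δ^0_{(bn+a)}(X) if and only if it and its complement
    are both Σ^0_{(bn+a)}(X) ([Delta_iff_Sigma]).  Granting this for all oracles,
    a hypothesis carrying Σ(Y)-sets to Σ(Z)-sets, applied to [S] and to its
    complement, carries Δ(Y)-sets to Δ(Z)-sets; lowness is the case Y = X, Z = ∅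
    and highness the case Y = ∅', Z = X.

    In Post's theorem the level bn+a-1 is a function of the input n alone, so on
    each input the two semi-decision procedures consult the same oracle and it
    suffices to find one program that runs both in parallel, whatever the oracle.
    Programs come with a big-step semantics, so parallel running needs a notion of
    stage.  The two programs are fixed, so this can be done one program at a time:
    by recursion on [c], [run X s c] is a total approximation to [c] at stage [s],
    monotone in [s] and with limit [c] ([run_mono], [eval_run]), and [clock c] is a
    program, the same for all oracles, computing it ([eval_clock]).  Then
    [decide p q] looks for the first stage at which [p] or [q] has halted and
    reports whether it was [p]. *)

Local Arguments Cantor.to_nat : simpl never.
Local Arguments Cantor.of_nat : simpl never.

(** * Evaluating programs *)

Section Eval.

Variable X : Ensemble nat.

Lemma eval_Fst (a b : nat) : eval X Fst ⟨a, b⟩ a.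
Proof. cbn [eval]; now rewrite cancel_of_to. Qed.

Lemma eval_Snd (a b : nat) : eval X Snd ⟨a, b⟩ b.
Proof. cbn [eval]; now rewrite cancel_of_to. Qed.

Lemma eval_Zero (x : nat) : eval X Zero x 0.
Proof. reflexivity. Qed.

Lemma eval_Succ (x : nat) : eval X Succ x (S x).
Proof. reflexivity. Qed.

Lemma eval_Pair (f g : prog) (x u v : nat) :
  eval X f x u -> eval X g x v -> eval X (Pair f g) x ⟨u, v⟩.
Proof. now exists u, v. Qed.

Lemma eval_Comp (f g : prog) (x u y : nat) :
  eval X g x u -> eval X f u y -> eval X (Comp f g) x y.
Proof. now exists u. Qed.

Lemma eval_Prec (f g : prog) (a n u : nat) (G : nat -> nat -> nat) :
  eval X f a u ->
  (forall m r, eval X g ⟨a, ⟨m, r⟩⟩ (G m r)) ->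
  eval X (Prec f g) ⟨a, n⟩ (nat_rect (fun _ => nat) u G n).
Proof.
intros Hf Hg; cbn [eval]; rewrite cancel_of_to; cbn [fst snd].
induction n as [|n IHn]; cbn; eauto.
Qed.

Local Ltac rearrange :=
  repeat first [apply eval_Fst | apply eval_Snd | apply eval_Succ
               | eapply eval_Pair | eapply eval_Comp].

(** ** Auxiliary programs *)

Definition Id : prog := Pair Fst Snd.

Lemma eval_Id (x : nat) : eval X Id x x.
Proof.
exists (fst (of_nat x)), (snd (of_nat x)); cbn [eval].
now rewrite <- surjective_pairing, cancel_to_of.
Qed.

Definition Case (f g : prog) : prog :=
  Prec f (Comp g (Pair Fst (Comp Fst Snd))).

(** Primitive recursion computes all earlier values as well, which is why [g] is
    asked to converge at every [m] and not only at the predecessor of [n]. *)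
Lemma eval_Case (f g : prog) (a n u : nat) (G : nat -> nat) :
  eval X f a u -> (forall m, eval X g ⟨a, m⟩ (G m)) ->
  eval X (Case f g) ⟨a, n⟩ match n with 0 => u | S m => G m end.
Proof.
intros Hf Hg.
replace (match n with 0 => u | S m => G m end)
  with (nat_rect (fun _ => nat) u (fun m _ => G m) n) by now destruct n.
apply eval_Prec; trivial; intros m r.
eapply eval_Comp; [rearrange | apply Hg].
Qed.

Definition Neg : prog := Comp (Case (Comp Succ Zero) Zero) (Pair Zero Id).

Lemma eval_Neg (x : nat) : eval X Neg x match x with 0 => 1 | S _ => 0 end.
Proof.
eapply eval_Comp.
- apply eval_Pair; [apply eval_Zero | apply eval_Id].
- apply eval_Case with (G := fun _ => 0); intros;
    eauto using eval_Comp, eval_Zero, eval_Succ.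
Qed.

Definition Sub : prog :=
  Prec Id (Comp (Case Zero Snd) (Pair Zero (Comp Snd Snd))).

Lemma eval_Sub (x y : nat) : eval X Sub ⟨x, y⟩ (x - y).
Proof.
replace (x - y) with
  (nat_rect (fun _ => nat) x
     (fun _ r => match r with 0 => 0 | S m => m end) y).
- apply eval_Prec; [apply eval_Id|]; intros m r.
  eapply eval_Comp; [apply eval_Pair; [apply eval_Zero|] |].
  + rearrange.
  + apply eval_Case with (G := fun m => m);
      auto using eval_Zero, eval_Snd.
- induction y as [|y IHy]; cbn; [lia|].
  rewrite IHy; destruct (x - y) eqn:E; lia.
Qed.

(** ** Minimization of total functions *)

Fixpoint first_zero (T : nat -> nat) (k : nat) : nat :=
  match k with
  | 0 => 0
  | S k => match T 0 with
           | 0 => 0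
           | S _ => S (first_zero (fun m => T (S m)) k)
           end
  end.

Lemma first_zero_lt (T : nat -> nat) (k m : nat) :
  m < first_zero T k -> T m <> 0.
Proof.
revert T m; induction k as [|k IHk]; cbn; intros T m; [lia|].
destruct (T 0) eqn:E; [lia|]; destruct m as [|m]; [lia|].
intros H; apply (IHk (fun m => T (S m))); lia.
Qed.

Lemma first_zero_spec (T : nat -> nat) (k : nat) :
  T k = 0 -> T (first_zero T k) = 0.
Proof.
revert T; induction k as [|k IHk]; cbn; intros T H; trivial.
destruct (T 0) eqn:E; trivial; now apply (IHk (fun m => T (S m))).
Qed.

Lemma first_zero_le (T : nat -> nat) (k : nat) : first_zero T k <= k.
Proof.
revert T; induction k as [|k IHk]; cbn; intros T; [lia|].
destruct (T 0); [lia|]; specialize (IHk (fun m => T (S m))); lia.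
Qed.

Lemma eval_Mu (f : prog) (T : nat -> nat) (x k : nat) :
  (forall m, eval X f ⟨x, m⟩ (T m)) -> T k = 0 ->
  eval X (Mu f) x (first_zero T k).
Proof.
intros Hf Hk; split.
- rewrite <- (first_zero_spec T k Hk); apply Hf.
- intros m Hm; exists (pred (T m)).
  apply first_zero_lt in Hm; rewrite Nat.succ_pred; trivial.
Qed.

(** * Stage-by-stage approximation *)

(** Only minimization can run forever, so the stage need only bound the search:
    at stage [s] candidates beyond [s] are not examined.  The cut-off at [s] is the
    truncated difference [s - m], which makes the search a minimization
    that always succeeds.  It may end at a candidate where the value is still
    unknown, or at [s] itself, hence the final test. *)
Fixpoint run (s : nat) (c : prog) (x : nat) : option nat :=
  match c with
  | Zero => Some 0
  | Succ => Some (S x)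
  | Fst => Some (fst (of_nat x))
  | Snd => Some (snd (of_nat x))
  | Oracle => Some (if excluded_middle_informative (In X x) then 1 else 0)
  | Pair f g =>
      match run s f x with
      | Some u => match run s g x with Some v => Some ⟨u, v⟩ | None => None end
      | None => None
      end
  | Comp f g => match run s g x with Some u => run s f u | None => None end
  | Prec f g =>
      let a := fst (of_nat x) in
      nat_rect (fun _ => option nat)
        (run s f a)
        (fun n o => match o with
                    | Some r => run s g ⟨a, ⟨n, r⟩⟩
                    | None => None
                    end)
        (snd (of_nat x))
  | Mu f =>
      let y := first_zero (fun m => match run s f ⟨x, m⟩ with
                                    | Some (S _) => s - m
                                    | _ => 0
                                    end) s in
      match run s f ⟨x, y⟩ with Some 0 => Some y | _ => None end
  end.

Lemma run_Mu (s : nat) (f : prog) (x y : nat) :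
  run s (Mu f) x = Some y <->
  y <= s /\ run s f ⟨x, y⟩ = Some 0 /\
  forall m, m < y -> exists k, run s f ⟨x, m⟩ = Some (S k).
Proof.
cbn [run].
set (T := fun m => match run s f ⟨x, m⟩ with Some (S _) => s - m | _ => 0 end).
assert (Hs : T s = 0).
{ unfold T; destruct (run s f ⟨x, s⟩) as [[|k]|]; trivial; lia. }
pose proof (first_zero_spec T s Hs) as Hz.
pose proof (first_zero_le T s) as Hle.
pose proof (first_zero_lt T s) as Hlt.
set (z := first_zero T s) in *; cbv zeta; split.
- destruct (run s f ⟨x, z⟩) as [[|k]|] eqn:E; try discriminate.
  intros [= <-]; repeat split; trivial; intros m Hm.
  specialize (Hlt m Hm); unfold T in Hlt.
  destruct (run s f ⟨x, m⟩) as [[|k]|]; try easy; now exists k.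
- intros (Hy & E & L).
  assert (z = y) as ->; [|now rewrite E].
  destruct (Nat.lt_trichotomy z y) as [H|[H|H]]; trivial; exfalso.
  + destruct (L z H) as [k Hk]; unfold T in Hz; rewrite Hk in Hz; lia.
  + apply (Hlt y H); unfold T; now rewrite E.
Qed.

Lemma run_mono (s t : nat) (c : prog) (x y : nat) :
  s <= t -> run s c x = Some y -> run t c x = Some y.
Proof.
intros Hst; revert x y.
induction c as [| | | | |f IHf g IHg|f IHf g IHg|f IHf g IHg|f IHf];
  intros x y; trivial.
- cbn [run]; destruct (run s f x) as [u|] eqn:Ef; [|easy].
  destruct (run s g x) as [v|] eqn:Eg; [|easy].
  now rewrite (IHf _ _ Ef), (IHg _ _ Eg).
- cbn [run]; destruct (run s g x) as [u|] eqn:Eg; [|easy].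
  rewrite (IHg _ _ Eg); apply IHf.
- cbn [run]; cbv zeta; generalize (fst (of_nat x)) as a; intros a.
  induction (snd (of_nat x)) as [|n IHn] in y |- *; cbn; [apply IHf|].
  destruct (nat_rect _ (run s f a) _ n) as [r|]; [|easy].
  rewrite (IHn r eq_refl); apply IHg.
- rewrite !run_Mu; intros (Hy & E & L); repeat split; [lia | auto |].
  intros m Hm; destruct (L m Hm) as [k Hk]; eauto.
Qed.

Lemma run_sound (s : nat) (c : prog) (x y : nat) :
  run s c x = Some y -> eval X c x y.
Proof.
revert x y.
induction c as [| | | | |f IHf g IHg|f IHf g IHg|f IHf g IHg|f IHf];
  intros x y; try (cbn; congruence).
- cbn; destruct excluded_middle_informative; intros [= <-]; auto.
- cbn [run]; destruct (run s f x) as [u|] eqn:Ef; [|easy].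
  destruct (run s g x) as [v|] eqn:Eg; [|easy].
  intros [= <-]; apply eval_Pair; auto.
- cbn [run]; destruct (run s g x) as [u|] eqn:Eg; [|easy].
  intros Ef; apply eval_Comp with u; auto.
- cbn [run eval]; cbv zeta; generalize (fst (of_nat x)) as a; intros a.
  induction (snd (of_nat x)) as [|n IHn] in y |- *; cbn; [apply IHf|].
  destruct (nat_rect _ (run s f a) _ n) as [r|]; [|easy].
  intros Eg; exists r; auto.
- rewrite run_Mu; intros (_ & E & L); split; auto.
  intros m Hm; destruct (L m Hm) as [k Hk]; eauto.
Qed.

(** A convergent computation has finitely many subcomputations, so by monotonicity
    the largest of the stages they need serves for all of them. *)
Lemma run_complete (c : prog) (x y : nat) :
  eval X c x y -> exists s, run s c x = Some y.
Proof.
revert x y.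
induction c as [| | | | |f IHf g IHg|f IHf g IHg|f IHf g IHg|f IHf];
  intros x y; try (intros ->; now exists 0).
- intros H; exists 0; cbn in *.
  destruct excluded_middle_informative; f_equal; intuition.
- intros (u & v & Hu & Hv & ->).
  apply IHf in Hu as [s Hs]; apply IHg in Hv as [t Ht].
  exists (max s t); cbn [run].
  rewrite (run_mono s (max s t) f x u), (run_mono t (max s t) g x v);
    trivial; lia.
- intros (u & Hu & Hy).
  apply IHg in Hu as [s Hs]; apply IHf in Hy as [t Ht].
  exists (max s t); cbn [run].
  rewrite (run_mono s (max s t) g x u), (run_mono t (max s t) f u y);
    trivial; lia.
- intros H.
  (* Splitting the input into a pair lets the induction on its second component
     keep the program [Prec f g], to which monotonicity applies. *)
  rewrite <- (cancel_to_of x) in H |- *.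
  destruct (of_nat x) as [a n]; clear x.
  induction n as [|n IHn] in y, H |- *;
    cbn [run eval] in *; rewrite cancel_of_to in *; cbn in H |- *.
  + now apply IHf.
  + destruct H as (r & Hr & Hy).
    apply IHn in Hr as [s Hs]; apply IHg in Hy as [t Ht].
    exists (max s t).
    pose proof (run_mono s (max s t) (Prec f g) ⟨a, n⟩ r) as M.
    cbn [run] in M; rewrite cancel_of_to in M; cbn [fst snd] in M, Hs.
    rewrite M; trivial; [|lia].
    apply (run_mono t); trivial; lia.
- intros [Hy L].
  apply IHf in Hy as [s Hs].
  assert (exists t, forall m, m < y -> exists k, run t f ⟨x, m⟩ = Some (S k))
    as [t Ht].
  { clear Hs; induction y as [|y IHy]; [exists 0; lia|].
    destruct IHy as [t Ht]; [auto|].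
    destruct (L y) as [k Hk]; [lia|]; apply IHf in Hk as [u Hu].
    exists (max t u); intros m Hm.
    destruct (Nat.eq_dec m y) as [->|H].
    - exists k; apply (run_mono u); trivial; lia.
    - destruct (Ht m) as [j Hj]; [lia|].
      exists j; apply (run_mono t); trivial; lia. }
  exists (max y (max s t)); apply run_Mu; repeat split; [lia| |].
  + apply (run_mono s); trivial; lia.
  + intros m Hm; destruct (Ht m Hm) as [k Hk].
    exists k; apply (run_mono t); trivial; lia.
Qed.

Lemma eval_run (c : prog) (x y : nat) :
  eval X c x y <-> exists s, run s c x = Some y.
Proof.
split; [apply run_complete|]; intros [s Hs]; exact (run_sound s c x y Hs).
Qed.

(** * The approximation is computable *)

Definition enc (o : option nat) : nat :=
  match o with None => 0 | Some y => S y end.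

Definition Bind (f g : prog) : prog := Comp (Case Zero g) (Pair Id f).

Lemma eval_Bind (f g : prog) (x : nat) (o : option nat) (K : nat -> option nat) :
  eval X f x (enc o) -> (forall r, eval X g ⟨x, r⟩ (enc (K r))) ->
  eval X (Bind f g) x (enc match o with Some r => K r | None => None end).
Proof.
intros Hf Hg; eapply eval_Comp; [apply eval_Pair; [apply eval_Id | exact Hf]|].
replace (enc match o with Some r => K r | None => None end)
  with (match enc o with 0 => 0 | S r => enc (K r) end) by now destruct o.
apply eval_Case with (G := fun r => enc (K r)); auto using eval_Zero.
Qed.

(** The program follows the recursion defining [run], with the stage passed along
    as a second component of the input. *)
Fixpoint clock (c : prog) : prog :=
  match c with
  | Zero | Succ | Fst | Snd | Oracle => Comp Succ (Comp c Fst)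
  | Pair f g =>
      Bind (clock f)
        (Bind (Comp (clock g) Fst) (Comp Succ (Pair (Comp Snd Fst) Snd)))
  | Comp f g => Bind (clock g) (Comp (clock f) (Pair Snd (Comp Snd Fst)))
  | Prec f g =>
      (* the recursion runs with parameter ⟨a, s⟩ *)
      Comp
        (Prec (clock f)
           (Bind (Comp Snd Snd)
              (* here the input is ⟨⟨⟨a, s⟩, ⟨n, _⟩⟩, r⟩ *)
              (Comp (clock g)
                 (Pair
                    (Pair (Comp Fst (Comp Fst Fst))
                       (Pair (Comp Fst (Comp Snd Fst)) Snd))
                    (Comp Snd (Comp Fst Fst))))))
        (Pair (Pair (Comp Fst Fst) Snd) (Comp Snd Fst))
  | Mu f =>
      (* from ⟨⟨x, s⟩, m⟩, stage [s] of [f] on ⟨x, m⟩ *)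
      let h := Comp (clock f)
                 (Pair (Pair (Comp Fst Fst) Snd) (Comp Snd Fst)) in
      let test := Comp
                    (Case Zero
                       (Case Zero
                          (Comp Sub (Pair (Comp Snd (Comp Fst Fst))
                                       (Comp Snd Fst)))))
                    (Pair Id h) in
      Comp
        (Comp (Case Zero (Case (Comp Succ Snd) Zero)) (Pair Id h))
        (Pair Id (Mu test))
  end.

Lemma eval_clock (c : prog) (x s : nat) :
  eval X (clock c) ⟨x, s⟩ (enc (run s c x)).
Proof.
revert x s.
induction c as [| | | | |f IHf g IHg|f IHf g IHg|f IHf g IHg|f IHf];
  intros x s; cbn [clock];
  try (eapply eval_Comp; [|apply eval_Succ];
       eapply eval_Comp; [apply eval_Fst|]; try reflexivity).
- cbn; destruct excluded_middle_informative; auto.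
- cbn [run].
  apply eval_Bind with (K := fun u =>
    match run s g x with Some v => Some ⟨u, v⟩ | None => None end); auto.
  intros u.
  apply eval_Bind with (K := fun v => Some ⟨u, v⟩).
  + eapply eval_Comp; [rearrange | apply IHg].
  + intros v; rearrange.
- cbn [run].
  apply eval_Bind with (K := run s f); auto; intros u.
  eapply eval_Comp; [rearrange | apply IHf].
- rewrite <- (cancel_to_of x); destruct (of_nat x) as [a n]; clear x.
  cbn [run]; rewrite cancel_of_to; cbn [fst snd].
  eapply eval_Comp; [rearrange |].
  set (step := fun m o =>
    match o with Some r => run s g ⟨a, ⟨m, r⟩⟩ | None => None end).
  (* the recursion only meets codes of options, but its step must be described
     on all numbers *)
  set (dec := fun r => match r with 0 => None | S r => Some r end).
  replace (enc (nat_rect (fun _ => option nat) (run s f a) step n))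
    with (nat_rect (fun _ => nat) (enc (run s f a))
            (fun m r => enc (step m (dec r))) n).
  + apply eval_Prec; [apply IHf|]; intros m r.
    unfold step; apply eval_Bind with (K := fun r => run s g ⟨a, ⟨m, r⟩⟩).
    * replace (enc (dec r)) with r by now destruct r.
      rearrange.
    * intros q; eapply eval_Comp; [|apply IHg].
      rearrange.
  + induction n as [|n IHn]; cbn; trivial.
    rewrite IHn; now destruct (nat_rect _ (run s f a) step n).
- set (h := Comp (clock f) (Pair (Pair (Comp Fst Fst) Snd) (Comp Snd Fst))).
  assert (Hh : forall m, eval X h ⟨⟨x, s⟩, m⟩ (enc (run s f ⟨x, m⟩))).
  { intros m; eapply eval_Comp; [|apply IHf].
    rearrange. }
  cbn [run]; cbv zeta.
  set (T := fun m => match run s f ⟨x, m⟩ with Some (S _) => s - m | _ => 0 end).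
  eapply eval_Comp.
  + apply eval_Pair; [apply eval_Id|].
    apply eval_Mu with (T := T) (k := s).
    * intros m; eapply eval_Comp; [apply eval_Pair; [apply eval_Id|apply Hh]|].
      replace (T m) with (match enc (run s f ⟨x, m⟩) with
        | 0 => 0 | S v => match v with 0 => 0 | S _ => s - m end end)
        by (unfold T; now destruct (run s f ⟨x, m⟩) as [[|]|]).
      apply eval_Case with
        (G := fun v => match v with 0 => 0 | S _ => s - m end);
        [apply eval_Zero|]; intros v.
      apply eval_Case with (G := fun _ => s - m); [apply eval_Zero|].
      intros ?; eapply eval_Comp; [|apply eval_Sub].
      rearrange.
    * unfold T; destruct (run s f ⟨x, s⟩) as [[|]|]; lia.
  + generalize (first_zero T s) as y; intros y.
    eapply eval_Comp; [apply eval_Pair; [apply eval_Id|apply Hh]|].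
    replace (enc match run s f ⟨x, y⟩ with Some 0 => Some y | _ => None end)
      with (match enc (run s f ⟨x, y⟩) with
        | 0 => 0 | S v => match v with 0 => S y | S _ => 0 end end)
      by now destruct (run s f ⟨x, y⟩) as [[|]|].
    apply eval_Case with
      (G := fun v => match v with 0 => S y | S _ => 0 end);
      [apply eval_Zero|]; intros v.
    apply eval_Case with (G := fun _ => 0); [|intros; apply eval_Zero].
    rearrange.
Qed.

(** * Running two programs in parallel *)

Definition decide (p q : prog) : prog :=
  Comp (Comp Neg (Comp Neg (clock p)))
    (Pair Id
       (Mu (Comp (Case (Comp Neg (clock q)) Zero) (Pair Id (clock p))))).

(** The search ends because one of the programs halts.  At the stage found, the
    approximation to [p] alone gives the answer: if it has halted then [q] never
    does, and if not then it is [q] that has halted. *)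
Lemma eval_decide (p q : prog) (x : nat) :
  (exists y, eval X p x y) \/ (exists y, eval X q x y) ->
  ~ ((exists y, eval X p x y) /\ (exists y, eval X q x y)) ->
  ((exists y, eval X p x y) -> eval X (decide p q) x 1) /\
  ((exists y, eval X q x y) -> eval X (decide p q) x 0).
Proof.
intros D N.
set (T := fun s => match enc (run s p x) with
  | 0 => match enc (run s q x) with 0 => 1 | S _ => 0 end
  | S _ => 0 end).
assert (HT : exists s, T s = 0).
{ unfold T; destruct D as [[y H]|[y H]]; apply eval_run in H as [s Hs];
    exists s; rewrite Hs; cbn; trivial; now destruct (enc _). }
destruct HT as [k Hk].
pose proof (first_zero_spec T k Hk) as Hz.
assert (E : eval X (decide p q) x
  match match enc (run (first_zero T k) p x) with 0 => 1 | S _ => 0 end with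
  | 0 => 1 | S _ => 0 end).
{ eapply eval_Comp.
  - apply eval_Pair; [apply eval_Id|].
    apply eval_Mu with (T := T) (k := k); trivial; intros s.
    eapply eval_Comp;
      [apply eval_Pair; [apply eval_Id | apply eval_clock]|].
    apply eval_Case with (G := fun _ => 0); [|intros; apply eval_Zero].
    eapply eval_Comp; [apply eval_clock | apply eval_Neg].
  - eapply eval_Comp; [|apply eval_Neg].
    eapply eval_Comp; [apply eval_clock | apply eval_Neg]. }
set (s := first_zero T k) in *; unfold T in Hz.
destruct (run s p x) as [y|] eqn:Ep; cbn in E, Hz.
- apply run_sound in Ep; split; trivial; intros Hq; exfalso; eauto.
- destruct (run s q x) as [z|] eqn:Eq; [|discriminate].
  apply run_sound in Eq; split; trivial; intros Hp; exfalso; eauto.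
Qed.

End Eval.

(** * Post's theorem, level by level *)

Lemma Delta_class_iff (a b : nat) (X S : Ensemble nat) :
  Delta_class a b X S <->
  exists p, forall n,
    (In S n -> eval (jumps (b * n + a - 1) X) p n 1) /\
    (~ In S n -> eval (jumps (b * n + a - 1) X) p n 0).
Proof.
split.
- intros [e He].
  (* [e] converges on every input, so it is a code *)
  assert (exists p, code p = e) as [p Hp].
  { destruct (He 0) as [H1 H0].
    destruct (classic (In S 0)) as [H|H];
      [destruct (H1 H) as (p & Hp & _) | destruct (H0 H) as (p & Hp & _)];
      now exists p. }
  exists p; intros n; destruct (He n) as [H1 H0].
  split; intros H; [destruct (H1 H) as (q & Hq & E)
                   | destruct (H0 H) as (q & Hq & E)];
    rewrite <- Hp in Hq; apply code_inj in Hq; now subst q.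
- intros [p Hp]; exists (code p); intros n; destruct (Hp n) as [H1 H0].
  split; intros H; exists p; auto.
Qed.

Lemma Sigma_class_iff (a b : nat) (X S : Ensemble nat) :
  Sigma_class a b X S <->
  exists p, forall n,
    In S n <-> exists y, eval (jumps (b * n + a - 1) X) p n y.
Proof.
split.
- intros [e He].
  destruct (classic (exists p, code p = e)) as [[p Hp]|N].
  + exists p; intros n; rewrite (He n); unfold In, W; split.
    * intros (y & q & Hq & E); rewrite <- Hp in Hq; apply code_inj in Hq.
      subst q; now exists y.
    * intros [y Hy]; exists y, p; auto.
  (* if [e] is not a code, then [S] is empty; the successor has no zero *)
  + exists (Mu Succ); intros n; rewrite (He n); split.
    * intros (y & q & Hq & _); elim N; now exists q.
    * intros (y & E & _); discriminate E.
- intros [p Hp]; exists (code p); intros n; rewrite (Hp n).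
  unfold In, W; split.
  + intros [y Hy]; exists y, p; auto.
  + intros (y & q & Hq & E); apply code_inj in Hq; subst q; now exists y.
Qed.

(** Applied to ⟨v, m⟩, [Fst] ignores the search variable m, so the search for a
    zero ends at once or never. *)
Lemma eval_halt_on_zero (X : Ensemble nat) (v : nat) :
  (exists y, eval X (Mu Fst) v y) <-> v = 0.
Proof.
split.
- intros (y & E & _); cbn [eval] in E; now rewrite cancel_of_to in E.
- intros ->; exists 0; split; [apply eval_Fst | lia].
Qed.

Lemma Delta_Complement (a b : nat) (X S : Ensemble nat) :
  Delta_class a b X S -> Delta_class a b X (Complement nat S).
Proof.
rewrite !Delta_class_iff; intros [p Hp].
exists (Comp Neg p); intros n; destruct (Hp n) as [H1 H0].
split; intros H; [apply H0 in H | apply NNPP, H1 in H];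
  eapply eval_Comp; try exact H; apply eval_Neg.
Qed.

Lemma Sigma_Complement_of_Delta (a b : nat) (X S : Ensemble nat) :
  Delta_class a b X S -> Sigma_class a b X (Complement nat S).
Proof.
rewrite Delta_class_iff, Sigma_class_iff; intros [p Hp].
exists (Comp (Mu Fst) p); intros n; destruct (Hp n) as [H1 H0]; split.
- intros H; apply H0 in H.
  destruct (proj2 (eval_halt_on_zero (jumps (b * n + a - 1) X) 0) eq_refl)
    as [y Hy].
  exists y; now apply eval_Comp with 0.
- intros (y & v & Hv & Hy) H; apply H1 in H.
  rewrite (eval_functional _ _ _ _ _ Hv H) in Hy.
  discriminate (proj1 (eval_halt_on_zero (jumps (b * n + a - 1) X) 1)
                  (ex_intro _ y Hy)).
Qed.

(** From right to left, the oracle depends on the input; a single program works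
    because [decide] is the same for all oracles. *)
Lemma Delta_iff_Sigma (a b : nat) (X S : Ensemble nat) :
  Delta_class a b X S <->
  Sigma_class a b X S /\ Sigma_class a b X (Complement nat S).
Proof.
split.
- intros D; split; [|now apply Sigma_Complement_of_Delta].
  apply Delta_Complement, Sigma_Complement_of_Delta in D.
  destruct D as [e He]; exists e; intros n; rewrite <- He.
  split; [intros H N; now apply N | apply NNPP].
- rewrite !Sigma_class_iff, Delta_class_iff; intros [[p Hp] [q Hq]].
  exists (decide p q); intros n.
  destruct (eval_decide (jumps (b * n + a - 1) X) p q n) as [H1 H0];
    rewrite <- ?Hp, <- ?Hq in *.
  + apply classic.
  + intros [H N]; exact (N H).
  + split; trivial.
Qed.

(** * Transfer of lowness and highness *)

Lemma Delta_mono_of_Sigma_mono (a b : nat) (Y Z : Ensemble nat) :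
  (forall S, Sigma_class a b Y S -> Sigma_class a b Z S) ->
  forall S, Delta_class a b Y S -> Delta_class a b Z S.
Proof.
intros H S; rewrite !Delta_iff_Sigma; intros [H1 H0]; auto.
Qed.

Theorem proposition2p5 (X : Ensemble nat) :
  (low_for_Sigma_Feiner X -> low_for_Delta_Feiner X) /\
  (high_for_Sigma_Feiner X -> high_for_Delta_Feiner X).
Proof.
split; intros (a & b & Hb & H); exists a, b; split; trivial;
  exact (Delta_mono_of_Sigma_mono a b _ _ H).
Qed.
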